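(* Let $Y$ be a set and let $\mathcal{L}$ be a $T_1$ sublattice of $2^Y$. Then $\chi(\Gamma(\mathcal{L})) = \operatorname{clique} \Gamma(\mathcal{L}) = |Y|$, the cardinality of $Y$.
   Context: A sublattice $\mathcal{L}$ of $2^Y$ means a bounded lattice of subsets of $Y$: a collection of subsets of $Y$ containing $\emptyset$ and $Y$ and closed under finite unions and finite intersections. It is $T_1$ if $\{y\}\in\mathcal{L}$ for all $y\in Y$. $\Gamma(\mathcal{L})$ denotes the zero-divisor graph of the semigroup $(\mathcal{L},\cap)$, whose absorbing element is $\emptyset$: its vertices are the nonempty $A\in\mathcal{L}$ such that $A\cap B=\emptyset$ for some nonempty $B\in\mathcal{L}$, and two distinct vertices $A,B$ are adjacent precisely when $A\cap B=\emptyset$. For a graph $G$: $\operatorname{clique} G$ is the supremum of the cardinalities of sets of vertices on which the induced subgraph is complete; $\chi(G)$ is the infimum of the cardinalities of sets $A$ for which there is a map from the vertices of $G$ to $A$ taking different values on adjacent vertices.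
   Formalization: The formal theorem assumes that Y does not have exactly one element; for |Y| = 1 the lattice is {∅, Y}, its zero-divisor graph has no vertices, and χ = clique = 0 ≠ 1 = |Y|. *)

(* Defs.v *)
From mathcomp Require Import all_boot all_classical.

Set Implicit Arguments.
Unset Strict Implicit.
Unset Printing Implicit Defensive.

Local Open Scope classical_set_scope.
Local Open Scope card_scope.

Record is_sublattice (Y : Type) (L : set (set Y)) : Prop := IsSublattice {
  sublattice0 : L set0;
  sublatticeT : L setT;
  sublatticeU : forall A B, L A -> L B -> L (A `|` B);
  sublatticeI : forall A B, L A -> L B -> L (A `&` B) }.

Definition T1_sublattice (Y : Type) (L : set (set Y)) : Prop :=
  is_sublattice L /\ forall y : Y, L [set y].

Record graph := Graph {
  vertex : Type;
  adj : vertex -> vertex -> Prop;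
  adj_sym : forall u v, adj u v -> adj v u;
  adj_irrefl : forall v, ~ adj v v }.

(* A cardinal is represented by any type of that cardinality, so suprema and
   infima of classes of cardinals are determined only up to equipotence. *)
Definition is_card_sup (P : Type -> Prop) (K : Type) : Prop :=
  (forall X, P X -> [set: X] #<= [set: K]) /\
  (forall Z : Type, (forall X, P X -> [set: X] #<= [set: Z]) ->
    [set: K] #<= [set: Z]).

Definition is_card_inf (P : Type -> Prop) (K : Type) : Prop :=
  (forall X, P X -> [set: K] #<= [set: X]) /\
  (forall Z : Type, (forall X, P X -> [set: Z] #<= [set: X]) ->
    [set: Z] #<= [set: K]).

Lemma is_card_sup_unique (P : Type -> Prop) (K1 K2 : Type) :
  is_card_sup P K1 -> is_card_sup P K2 -> [set: K1] #= [set: K2].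
Proof.
move=> [u1 l1] [u2 l2]; rewrite card_eq_le.
by apply/andP; split; [exact: l1|exact: l2].
Qed.

Lemma is_card_inf_unique (P : Type -> Prop) (K1 K2 : Type) :
  is_card_inf P K1 -> is_card_inf P K2 -> [set: K1] #= [set: K2].
Proof.
move=> [u1 l1] [u2 l2]; rewrite card_eq_le.
by apply/andP; split; [exact: l2|exact: l1].
Qed.

Definition is_clique (G : graph) (C : set (vertex G)) : Prop :=
  forall u v, C u -> C v -> u <> v -> adj u v.

Definition proper_coloring (G : graph) (A : Type) (f : vertex G -> A) : Prop :=
  forall u v, adj u v -> f u <> f v.

Definition clique_number_is (G : graph) (K : Type) : Prop :=
  is_card_sup (fun X => exists2 C : set (vertex G), is_clique C & [set: X] #= C)
    K.

Definition chromatic_number_is (G : graph) (K : Type) : Prop :=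
  is_card_inf (fun A => exists f : vertex G -> A, proper_coloring f) K.

Definition zd_vertices (Y : Type) (L : set (set Y)) : set (set Y) :=
  [set A | [/\ L A, A <> set0 &
    exists B, [/\ L B, B <> set0 & A `&` B = set0]]].

Definition zd_adj (Y : Type) (L : set (set Y))
    (u v : {A : set Y | zd_vertices L A}) : Prop :=
  u <> v /\ sval u `&` sval v = set0.

Lemma zd_adj_sym (Y : Type) (L : set (set Y))
  (u v : {A : set Y | zd_vertices L A}) : zd_adj u v -> zd_adj v u.
Proof. by move=> [neq uv0]; split; [move=> /esym|rewrite setIC]. Qed.

Lemma zd_adj_irrefl (Y : Type) (L : set (set Y))
  (v : {A : set Y | zd_vertices L A}) : ~ zd_adj v v.
Proof. by case. Qed.

Definition zero_divisor_graph (Y : Type) (L : set (set Y)) : graph :=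
  Graph (@zd_adj_sym Y L) (@zd_adj_irrefl Y L).

(* Main.v *)
Require Import Defs.
From mathcomp Require Import all_boot all_classical.

Local Open Scope classical_set_scope.
Local Open Scope card_scope.

(** A proper coloring is injective on every clique, so each clique is at most as
large as each color set.  Hence a clique and a color set of the same cardinality
[K] pin both the clique number and the chromatic number to [K]
([tight_clique_coloring]).

In the zero-divisor graph of a T1 lattice on [Y], both are indexed by the points
of [Y].  Distinct singletons are disjoint, and each singleton is a zero divisor
because [Y] has another point, so the singletons form a clique equipotent to [Y]
([point_cliqueP], [card_point_clique]).  Coloring each vertex, a nonempty set,
by one of its elements is proper because adjacent vertices are disjoint
([element_coloring]).  If [Y] is empty, the graph has no vertex and the same
argument applies; on a one-point [Y] the singleton would not be a zero
divisor. *)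

Lemma clique_le_coloring (G : graph) (A : Type) (C : set (vertex G))
    (f : vertex G -> A) :
  is_clique C -> proper_coloring f -> C #<= [set: A].
Proof.
move=> cC pf; have injf : {in C &, injective f}.
  move=> u v /set_mem Cu /set_mem Cv fuv; apply: contrapT => uv.
  by apply: pf fuv; exact: cC.
by rewrite -(card_le_eql (inj_card_eq injf)); exact: card_leT.
Qed.

(** The clique bounds every color set from below, and the coloring bounds every
clique from above; both bounds are attained at [K]. *)
Lemma tight_clique_coloring (G : graph) (K : Type) (C : set (vertex G))
    (f : vertex G -> K) :
  is_clique C -> [set: K] #= C -> proper_coloring f ->
  chromatic_number_is G K /\ clique_number_is G K.
Proof.
move=> cC KC pf; split; split.
- by move=> X [g pg]; rewrite (card_le_eql KC); exact: clique_le_coloring pg.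
- by move=> Z; apply; exists f.
- move=> X [D cD XD]; rewrite (card_le_eql XD).
  exact: clique_le_coloring cD pf.
- by move=> Z; apply; exists C.
Qed.

Lemma exists_other_point (Y : Type) (y : Y) :
  [set: Y] #!= [set: unit] -> exists z : Y, z <> y.
Proof.
move=> /negP hY; apply: contrapT => no_other; apply: hY.
apply: card_esym; have -> : [set: Y] = (fun=> y) @` [set: unit].
  apply/seteqP; split=> // z _; exists tt => //.
  by apply: contrapT => yz; apply: no_other; exists z => zy; apply: yz.
by apply: card_esym; apply: inj_card_eq; move=> [] [].
Qed.

(** Another point [z] gives the witness: [[set y]] is annihilated by [[set z]]. *)
Lemma zd_vertices_point (Y : Type) (L : set (set Y)) (y : Y) :
  T1_sublattice L -> [set: Y] #!= [set: unit] -> zd_vertices L [set y].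
Proof.
move=> [_ Lpt] /(exists_other_point Y y)[z zy].
have pt0 (x : Y) : [set x] <> set0 by move/seteqP => [/(_ x erefl)].
split; [exact: Lpt | exact: pt0 | exists [set z]; split].
- exact: Lpt.
- exact: pt0.
- by apply/seteqP; split=> x //= [xy xz]; apply: zy; rewrite -xy -xz.
Qed.

Lemma zd_vertex_inj (Y : Type) (L : set (set Y))
    (u v : vertex (zero_divisor_graph L)) : sval u = sval v -> u = v.
Proof. by apply: eq_sig_hprop => A; exact: Prop_irrelevance. Qed.

Definition point_clique {Y : Type} (L : set (set Y)) :
    set (vertex (zero_divisor_graph L)) :=
  [set v | exists y, sval v = [set y]].

Lemma point_cliqueP (Y : Type) (L : set (set Y)) : is_clique (point_clique L).
Proof.
move=> u v [y uy] [z vz] uv; split=> //; rewrite uy vz.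
apply/seteqP; split=> x //= [xy xz]; apply: uv; apply: zd_vertex_inj.
by rewrite uy vz -xy -xz.
Qed.

Lemma card_point_clique (Y : Type) (L : set (set Y)) :
  T1_sublattice L -> [set: Y] #!= [set: unit] -> [set: Y] #= point_clique L.
Proof.
move=> hL hY.
pose pt y : vertex (zero_divisor_graph L) :=
  exist _ [set y] (zd_vertices_point Y L y hL hY).
have -> : point_clique L = pt @` [set: Y].
  apply/seteqP; split=> v.
    by move=> [y vy]; exists y => //; apply: zd_vertex_inj; rewrite vy.
  by move=> [y _ <-]; exists y.
apply: card_esym; apply: inj_card_eq => y z _ _ /(congr1 sval) /= yz.
by have : [set z] y by rewrite -yz.
Qed.

Lemma element_coloring (Y : Type) (L : set (set Y)) :
  exists f : vertex (zero_divisor_graph L) -> Y, proper_coloring f.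
Proof.
have nonempty (v : vertex (zero_divisor_graph L)) : exists y, sval v y.
  by have [_ /eqP/set0P] := svalP v.
have [f fP] := choice nonempty; exists f => u v [_ uv0] fuv.
have : (sval u `&` sval v) (f u) by split; [|rewrite fuv]; exact: fP.
by rewrite uv0.
Qed.

Theorem theorem5p2 (Y : Type) (L : set (set Y)) (hL : T1_sublattice L)
    (hY : [set: Y] #!= [set: unit]) :
  chromatic_number_is (zero_divisor_graph L) Y /\
  clique_number_is (zero_divisor_graph L) Y.
Proof.
have [f pf] := element_coloring Y L.
apply: tight_clique_coloring (card_point_clique Y L hL hY) pf.
exact: point_cliqueP.
Qed.
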